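(* Let $n\ge 1$ and let $\xi(x)$, $x\in\mathbb{R}^n$, be a real-valued measurable mean-square continuous homogeneous isotropic Gaussian random field with zero mean, whose isotropic spectral density $\varphi$ has the form $$\varphi(|\lambda|)=\frac{h(|\lambda|)}{|\lambda|^{n-\alpha_0}}\prod_{i=1}^{k-1}\frac{1}{\bigl||\lambda|-a_i\bigr|^{1-\alpha_i}},\qquad \lambda\in\mathbb{R}^n,$$ where $k\in\mathbb{N}$, $0=a_0<a_1<\dots<a_{k-1}$, $0<\alpha_0<n$, $0<\alpha_i<1$ for $i=1,\dots,k-1$, the function $\lambda\mapsto\varphi(|\lambda|)$ belongs to $L_1(\mathbb{R}^n)$, and $h\ge 0$ is a bounded function on $[0,+\infty)$ which is continuous in some neighbourhood of each $a_i$ and satisfies $h(a_i)\neq 0$, $i=0,\dots,k-1$. Let $a\in[0,+\infty)$ with $a\notin\{a_0,\dots,a_{k-1}\}$, and let $f_{a,r}:\mathbb{R}^n\to\mathbb{R}$, $r>0$, be a family of admissible weight functions at $a$ (as defined in the context). Then for every $\alpha$ with $0<\alpha<1$ the finite-dimensional distributions of the process $$X_{r,a}(t)=\begin{cases}\displaystyle\frac{1}{r^{\,n-\alpha/2}}\int_{\mathbb{R}^n}f_{a,rt}(x)\,\xi(x)\,dx, & t\in(0,1],\\[2mm] 0,& t=0,\end{cases}$$ converge to $0$ as $r\to+\infty$.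
   Context: Isotropic spectral density: the field $\xi$ has isotropic spectral density $\varphi:[0,\infty)\to[0,\infty)$ if $\lambda^{n-1}\varphi(\lambda)\in L_1([0,\infty))$ and the spectral function is $\mathbf{\Phi}(|u|)=\frac{2\pi^{n/2}}{\Gamma(n/2)}\int_0^{|u|}z^{n-1}\varphi(z)\,dz$. Equivalently, $\xi$ has the spectral representation $\xi(x)=\int_{\mathbb{R}^n}e^{i\langle\lambda,x\rangle}\sqrt{\varphi(|\lambda|)}\,dW(\lambda)$, where $W$ is the Wiener measure on $(\mathbb{R}^n,\mathfrak{B}^n)$ (Gaussian white noise on the Borel $\sigma$-algebra $\mathfrak{B}^n$ with Lebesgue control measure, understood to be complex-valued with $W(-A)=\overline{W(A)}$ for a real field), so that $\mathrm{cov}(\xi(y+x),\xi(y))=\int_{\mathbb{R}^n}e^{i\langle\lambda,x\rangle}\varphi(|\lambda|)\,d\lambda$. Admissible weight functions at a point $a\ge 0$: a family of radial, essentially non-zero functions $f_{a,r}:\mathbb{R}^n\to\mathbb{R}$, $r>0$, such that (1) $f_{a,r}\in L_1(\mathbb{R}^n)\cap L_2(\mathbb{R}^n)$; (2) the Fourier transform of $r^{-n}f_{a,r}$ has the form $g_a(r(|\lambda|-a))$, that is, $r^{-n}\int_{\mathbb{R}^n}e^{i\langle\lambda,x\rangle}f_{a,r}(x)\,dx=g_a(r(|\lambda|-a))$, with a function $g_a$ not depending on $r$; (3) $g_a(s)$, $s\in\mathbb{R}$, is an even function, and there is a constant $C$ with $g_a^2(s)\le C/s$ for all $s>0$. *)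

(* Defs.v *)
From HB Require Import structures.
From mathcomp Require Import all_boot all_order all_algebra.
From mathcomp Require Import complex.
From mathcomp Require Import all_classical all_reals all_analysis.

Set Implicit Arguments.
Unset Strict Implicit.
Unset Printing Implicit Defensive.

Import Order.TTheory GRing.Theory Num.Theory.
Import numFieldNormedType.Exports.

Local Open Scope classical_set_scope.
Local Open Scope ring_scope.

(* The library equips n.-tuple T, but not 'rV[T]_n, with the product
   sigma-algebra.  On 'rV[R]_n this is the Borel sigma-algebra of R^n. *)
Definition measure_row_display : measure_display -> measure_display.
Proof. exact. Qed.

Section measurable_row.
Context {d} {T : measurableType d}.
Variable n : nat.

Definition row_coors (i : 'I_n) (x : 'rV[T]_n) : T := x ord0 i.

Let row_set0 : g_sigma_preimage row_coors set0.
Proof. exact: sigma_algebra0. Qed.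

Let row_setC A : g_sigma_preimage row_coors A -> g_sigma_preimage row_coors (~` A).
Proof. exact: sigma_algebraC. Qed.

Let row_bigcup (F : _^nat) : (forall i, g_sigma_preimage row_coors (F i)) ->
  g_sigma_preimage row_coors (\bigcup_i (F i)).
Proof. exact: sigma_algebra_bigcup. Qed.

HB.instance Definition _ := @isMeasurable.Build (measure_row_display d)
  'rV[T]_n (g_sigma_preimage row_coors) row_set0 row_setC row_bigcup.

Lemma measurable_row_coors (i : 'I_n) : measurable_fun [set: 'rV[T]_n] (row_coors i).
Proof.
move=> _ Y mY; rewrite setTI; apply: sub_sigma_algebra => /=.
rewrite (bigD1 i) //=; left.
by exists Y => //; rewrite setTI.
Qed.

Lemma measurable_rowP d1 (T1 : measurableType d1) (f : T1 -> 'rV[T]_n) :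
  (forall i, measurable_fun [set: T1] (fun x => f x ord0 i)) ->
  measurable_fun [set: T1] f.
Proof.
move=> mf; apply: (@measurability _ _ _ _ _ _
  (\big[setU/set0]_(i < n) preimage_set_system setT (row_coors i) measurable)) => //.
move=> _ [A + <-]; move: A.
elim/big_ind : _ => //.
- by move=> A B hA hB C [/hA|/hB].
- move=> i _ _ [B mB <-]; rewrite !setTI.
  by have := mf i measurableT B mB; rewrite setTI.
Qed.

End measurable_row.

Section lebesgue_row.
Variable R : realType.

Definition row_cons n (p : measurableTypeR R * 'rV[R]_n) : 'rV[R]_n.+1 :=
  \row_(i < n.+1) if unlift ord0 i is Some j then p.2 ord0 j else p.1.

Definition row_uncons n (x : 'rV[R]_n.+1) : measurableTypeR R * 'rV[R]_n :=
  (x ord0 ord0, \row_(j < n) x ord0 (lift ord0 j)).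

Lemma row_consK n : cancel (@row_cons n) (@row_uncons n).
Proof.
move=> [a v]; rewrite /row_cons /row_uncons; congr (_, _).
  by rewrite mxE unlift_none.
by apply/rowP => j; rewrite !mxE liftK.
Qed.

Lemma measurable_row_cons n : measurable_fun setT (@row_cons n).
Proof.
apply: measurable_rowP => i.
under eq_fun do rewrite mxE.
case: unliftP => [j _|_]; last exact: measurable_fst.
by apply: measurableT_comp (measurable_row_coors j) _; exact: measurable_snd.
Qed.

Lemma measurable_row_uncons n : measurable_fun setT (@row_uncons n).
Proof.
apply: measurable_fun_pair; first exact: measurable_row_coors.
apply: measurable_rowP => j.
under eq_fun do rewrite mxE.
exact: measurable_row_coors.
Qed.

Section step.
Variables (n : nat) (mu : {sigma_finite_measure set 'rV[R]_n -> \bar R}).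

Definition lebesgue_step : set 'rV[R]_n.+1 -> \bar R :=
  pushforward (lebesgue_measure \x mu)%E (@row_cons n).
Let lebesgue_step0 : lebesgue_step set0 = 0%E.
Proof. by rewrite /lebesgue_step /pushforward preimage_set0 measure0. Qed.

Let lebesgue_step_ge0 A : (0 <= lebesgue_step A)%E.
Proof. by rewrite /lebesgue_step /pushforward measure_ge0. Qed.

Let lebesgue_step_sigma_additive : semi_sigma_additive lebesgue_step.
Proof.
exact: (@measure_semi_sigma_additive _ _ _
  (pushforward (lebesgue_measure \x mu)%E (mfun_Sub (mem_set (@measurable_row_cons n))))).
Qed.

HB.instance Definition _ := isMeasure.Build _ _ _ lebesgue_step
  lebesgue_step0 lebesgue_step_ge0 lebesgue_step_sigma_additive.

Let lebesgue_step_sigma_finite : sigma_finite setT lebesgue_step.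
Proof.
have /sigma_finiteP[F [TF ndF Foo]] : sigma_finite setT (@lebesgue_measure R).
  exact: sigma_finiteT.
have /sigma_finiteP[G [TG ndG Goo]] := sigma_finiteT mu.
exists (fun i => @row_uncons n @^-1` (F i `*` G i)).
  rewrite -preimage_bigcup (_ : \bigcup_i _ = setT) ?preimage_setT//.
  rewrite predeqE => -[x y]; split => // _.
  have [i _ Fix] : (\bigcup_i F i) x by rewrite -TF.
  have [j _ Gjy] : (\bigcup_i G i) y by rewrite -TG.
  exists (maxn i j) => //; split => /=.
  - by move: x Fix; exact/subsetPset/ndF/leq_maxl.
  - by move: y Gjy; exact/subsetPset/ndG/leq_maxr.
move=> i; have [mF Fi] := Foo i; have [mG Gi] := Goo i.
have mFG : measurable (F i `*` G i) by exact: measurableX.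
split; first by have := @measurable_row_uncons n measurableT _ mFG; rewrite setTI.
rewrite /lebesgue_step /pushforward -comp_preimage.
rewrite (_ : _ \o _ = id) ?preimage_id; last first.
  by apply/funext => x /=; rewrite row_consK.
by rewrite product_measure1E// lte_mul_pinfty// ge0_fin_numE.
Qed.

HB.instance Definition _ :=
  Measure_isSigmaFinite.Build _ _ _ lebesgue_step lebesgue_step_sigma_finite.

End step.

(* Lebesgue measure on R^n, as an iterated product measure. *)
Fixpoint lebesgue_row (n : nat) : {sigma_finite_measure set 'rV[R]_n -> \bar R} :=
  match n with
  | 0 => \d_(0 : 'rV[R]_0)
  | m.+1 => lebesgue_step (lebesgue_row m)
  end.

Lemma lebesgue_row_box n (A : 'I_n -> set R) : (forall i, measurable (A i)) ->
  lebesgue_row n [set x : 'rV[R]_n | forall i, A i (x ord0 i)] =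
  (\prod_(i < n) lebesgue_measure (A i))%E.
Proof.
elim: n A => [|n IHn] A mA.
  by rewrite big_ord0 /= diracE mem_set// => -[].
pose B : set 'rV[R]_n := [set x : 'rV[R]_n | forall j, A (lift ord0 j) (x ord0 j)].
have mB : measurable B.
  rewrite (_ : B = \bigcap_(j in [set: 'I_n]) (row_coors j @^-1` A (lift ord0 j))).
    apply: fin_bigcap_measurable => // j _.
    by have := measurable_row_coors j measurableT (mA (lift ord0 j)); rewrite setTI.
  by apply/seteqP; split => x /= h j => [_|]; exact: h.
rewrite big_ord_recl -(IHn (fun j => A (lift ord0 j)))//= -/B.
have -> : [set x : 'rV[R]_n.+1 | forall i, A i (x ord0 i)] =
          @row_uncons n @^-1` (A ord0 `*` B).
  apply/seteqP; split => x /= h.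
    by split => [|j]; [exact: h|rewrite mxE; exact: h].
  case: h => h0 h i; case: (unliftP ord0 i) => [j ->|->]//.
  by have := h j; rewrite mxE.
rewrite /lebesgue_step /pushforward -comp_preimage.
rewrite (_ : _ \o _ = id); last by apply/funext => x /=; rewrite row_consK.
by rewrite preimage_id product_measure1E//; exact: mA.
Qed.

End lebesgue_row.

Section euclidean.
Context {R : realType} {n : nat}.

Definition dotr (x y : 'rV[R]_n) : R := \sum_(i < n) x ord0 i * y ord0 i.

(* The library norm of 'rV[R]_n is the max norm. *)
Definition enorm (x : 'rV[R]_n) : R := Num.sqrt (dotr x x).

Definition radial (f : 'rV[R]_n -> R) := forall x y, enorm x = enorm y -> f x = f y.

End euclidean.

Section complex_integral.
Context {R : realType}.

Definition cexpi (t : R) : R[i] := (cos t +i* sin t)%C.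

Definition Cintegral d (T : measurableType d) (mu : {measure set T -> \bar R}) (D : set T)
    (f : T -> R[i]) : R[i] :=
  ((\int[mu]_(x in D) complex.Re (f x)) +i* (\int[mu]_(x in D) complex.Im (f x)))%C.

Definition fourier n (f : 'rV[R]_n -> R) (l : 'rV[R]_n) : R[i] :=
  Cintegral (lebesgue_row R n) setT (fun x => cexpi (dotr l x) * (f x)%:C%C).

(* Euler's Gamma function, for s > 0. *)
Definition Gamma (s : R) : R :=
  \int[lebesgue_measure]_(t in `]0, +oo[) (t `^ (s - 1) * expR (- t)).

End complex_integral.

Section random_fields.
Context {R : realType} {d : measure_display} {Omega : measurableType d}.
Variable P : probability Omega R.

(* The library's normal_prob is meaningful only for s != 0; degenerate
   Gaussian laws are included here. *)
Definition gaussian_rv (X : Omega -> R) := exists m s : R,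
  forall A : set R, measurable A ->
    P (X @^-1` A) = if s == 0 then \d_m A else normal_prob m s A.

Variable n : nat.
Implicit Type xi : 'rV[R]_n -> Omega -> R.

Definition measurable_field xi :=
  measurable_fun [set: Omega * 'rV[R]_n] (fun p => xi p.2 p.1).

Definition gaussian_field xi :=
  forall (m : nat) (x : 'I_m -> 'rV[R]_n) (c : 'I_m -> R),
    gaussian_rv (fun w => \sum_(i < m) c i * xi (x i) w).

Definition zero_mean xi := forall x, 'E_P[xi x]%E = 0%E.

Definition mean_square_continuous xi := forall x : 'rV[R]_n,
  'E_P[fun w => ((xi y w - xi x w) ^+ 2)%R]%E @[y --> x] --> 0%E.

(* Wide-sense homogeneity and isotropy. *)
Definition homogeneous_isotropic xi :=
  (forall x y, 'E_P[xi x]%E = 'E_P[xi y]%E) /\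
  (forall x y x' y', enorm (x - y) = enorm (x' - y') ->
    covariance P (xi x) (xi y) = covariance P (xi x') (xi y')).

Definition spectral_measure xi (F : {finite_measure set 'rV[R]_n -> \bar R}) :=
  forall x y, (fine (covariance P (xi (y + x)) (xi y)))%:C%C =
    Cintegral F setT (fun l => cexpi (dotr l x)).

Definition spectral_function (F : {finite_measure set 'rV[R]_n -> \bar R}) (u : R) : R :=
  fine (F [set l | enorm l < u]).

(* For an isotropic field the spectral measure is unique (Bochner) and rotation
   invariant, so it is determined by the spectral function. *)
Definition isotropic_spectral_density xi (phi : R -> R) :=
  [/\ forall z : R, 0 <= z -> 0 <= phi z,
      lebesgue_measure.-integrable `[0, +oo[ (fun z => (z ^+ n.-1 * phi z)%:E) &
      exists2 F, spectral_measure xi F &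
        forall u : R, 0 <= u -> spectral_function F u =
          2 * pi `^ (n%:R / 2) / Gamma (n%:R / 2) *
          \int[lebesgue_measure]_(z in `[0, u]) (z ^+ n.-1 * phi z)].

(* Pathwise integral: for a measurable mean-square continuous homogeneous field
   and f r in L1, the integrand is integrable for almost every w. *)
Definition weighted_process (f : R -> 'rV[R]_n -> R) xi (alpha r t : R) (w : Omega) : R :=
  if t == 0 then 0
  else (r `^ (n%:R - alpha / 2))^-1 *
       \int[lebesgue_row R n]_x (f (r * t) x * xi x w).

End random_fields.

Section convergence.
Context {R : realType} {d : measure_display} {Omega : measurableType d}.
Variable P : probability Omega R.

Definition cvg_in_distribution (I : Type) (G : set_system I) (m : nat)
    (X : I -> Omega -> 'rV[R]_m) (Y : Omega -> 'rV[R]_m) :=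
  forall g : 'rV[R]_m -> R, continuous g -> (exists M : R, forall v, `|g v| <= M) ->
    'E_P[g \o X i]%E @[i --> G] --> 'E_P[g \o Y]%E.

(* Convergence along G of the finite-dimensional distributions of processes
   indexed by T. *)
Definition cvg_fdd (I : Type) (G : set_system I) (T : set R)
    (X : I -> R -> Omega -> R) (Y : R -> Omega -> R) :=
  forall (m : nat) (t : 'I_m -> R), (forall j, T (t j)) ->
    cvg_in_distribution G (fun i w => \row_(j < m) X i (t j) w)
      (fun w => \row_(j < m) Y (t j) w).

End convergence.

Section weights.
Context {R : realType} {n : nat}.

Definition admissible_weights (a : R) (f : R -> 'rV[R]_n -> R) :=
  (forall r : R, 0 < r ->
    [/\ radial (f r),
        ~ {ae lebesgue_row R n, forall x, f r x = 0},
        f r \in Lfun (lebesgue_row R n) 1 &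
        f r \in Lfun (lebesgue_row R n) 2%:E]) /\
  exists g : R -> R,
    [/\ forall (r : R) l, 0 < r ->
          (r ^- n)%:C%C * fourier (f r) l = (g (r * (enorm l - a)))%:C%C,
        forall s, g (- s) = g s &
        exists C : R, forall s : R, 0 < s -> g s ^+ 2 <= C / s].

End weights.

(* Main.v *)
Require Import Defs.
From HB Require Import structures.
From mathcomp Require Import all_boot all_order all_algebra.
From mathcomp Require Import all_classical all_reals all_analysis.
From mathcomp Require Import measurable_realfun.
From mathcomp Require Import ring lra.

Import Order.TTheory GRing.Theory Num.Theory.
Import numFieldNormedType.Exports.

Local Open Scope classical_set_scope.
Local Open Scope ring_scope.

(** The process is an integral of the field against f_(a,rt), so its mean square
    can be computed on the spectral side: it is r^(alpha-2n) times the integral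
    of the squared Fourier transform of f_(a,rt) against the spectral measure F,
    that is
      r^(alpha-2n) (rt)^(2n) int g(rt(|l| - a))^2 F(dl).
    Since a is not one of the singular points, the spectral density is bounded
    near |l| = a, and the shell ||l| - a| < e has F-measure O(e).  Moreover g is
    bounded and g(s)^2 <= C/|s|, so the integral is O(1/(rt)) up to a
    logarithm.  The mean square is therefore r^(alpha-1) up to a logarithm and,
    as alpha < 1, tends to 0; a process which tends to 0 in mean square tends to
    0 in distribution.

    The isometry between mean squares and spectral integrals rests on
    integral_sqr_Rintegral: by Fubini, the mean square of int f(x) K(s,x) dx only
    depends on the second-moment function int K(s,x) K(s,y) ds of the kernel K.
    The field xi, as a kernel on Omega, and cas(<l,x>) = cos<l,x> + sin<l,x>, as
    a kernel on the frequencies with the measure F, have the same second-moment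
    function (integral_fieldM, integral_casM), because the covariance is real.
    This gives integral_sqr_weighted_field, without stochastic integrals.

    The integral of g^2 is estimated in layer_integral by cutting the
    neighbourhood of the sphere |l| = a into N geometric layers of ratio
    (rt)^(1/N).  A fixed N with 1/N < 1 - alpha replaces the logarithm by the
    harmless factor (rt)^(1/N). *)

(** * Mean squares of weighted integrals of a kernel *)

Section square_measure.
Context {d} {T : measurableType d} {R : realType}.
Variable mu : {sigma_finite_measure set T -> \bar R}.

(** The product measure mu x mu under a name of its own, so that it can carry a
    sigma-finite structure: Fubini's theorem is applied to S * (T * T). *)
Definition square_measure : set (T * T)%type -> \bar R := (mu \x mu)%E.

HB.instance Definition _ := Measure.on square_measure.

Lemma square_measure_sigma_finite : sigma_finite setT square_measure.
Proof.
have /sigma_finiteP[F [FT ndF Ffin]] := sigma_finiteT mu.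
exists (fun i => F i `*` F i) => [|i]; last first.
  have [mF Fi] := Ffin i; split; first exact: measurableX.
  by rewrite /square_measure product_measure1E// lte_mul_pinfty// ge0_fin_numE.
apply/esym/seteqP; split=> // -[x y] _.
have [[i _ Fix] [j _ Fjy]] : (\bigcup_i F i) x /\ (\bigcup_i F i) y by rewrite -FT.
exists (maxn i j) => //; split=> /=.
- by apply: (subsetPset _ _ (ndF _ _ (leq_maxl i j))).
- by apply: (subsetPset _ _ (ndF _ _ (leq_maxr i j))).
Qed.

HB.instance Definition _ := Measure_isSigmaFinite.Build _ _ _ square_measure
  square_measure_sigma_finite.

End square_measure.

Section second_moment.
Context {d1 d2} {S : measurableType d1} {T : measurableType d2} {R : realType}.
Variables (nu : {finite_measure set S -> \bar R})
  (mu : {sigma_finite_measure set T -> \bar R}).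

Lemma integrable_tensor (u v : T -> R) :
  mu.-integrable setT (EFin \o u) -> mu.-integrable setT (EFin \o v) ->
  (mu \x mu)%E.-integrable setT (fun z => (u z.1 * v z.2)%:E).
Proof.
move=> iu iv.
have mu1 : measurable_fun setT u by apply/measurable_EFinP; exact: measurable_int iu.
have mv1 : measurable_fun setT v by apply/measurable_EFinP; exact: measurable_int iv.
apply/integrable12ltyP.
  apply/measurable_EFinP; apply: measurable_funM.
    by apply: measurableT_comp mu1 _; exact: measurable_fst.
  by apply: measurableT_comp mv1 _; exact: measurable_snd.
have /integrableP[_ iu1] := iu; have /integrableP[_ iv1] := iv.
under eq_integral => x _.
  under eq_integral => y _ do rewrite /= normrM EFinM.
  rewrite ge0_integralZl//=; last by do 2 apply: measurableT_comp => //.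
  over.
rewrite ge0_integralZr//=; last 2 first.
- by do 2 apply: measurableT_comp => //.
- exact: integral_ge0.
by rewrite lte_mul_pinfty ?integral_ge0// ge0_fin_numE ?integral_ge0.
Qed.

Lemma integral_tensor (u v : T -> R) :
  mu.-integrable setT (EFin \o u) -> mu.-integrable setT (EFin \o v) ->
  (\int[mu \x mu]_z (u z.1 * v z.2)%:E =
   ((\int[mu]_x u x)%R * (\int[mu]_x v x)%R)%:E)%E.
Proof.
move=> iu iv.
rewrite -(integral12_prod_meas1 (f := fun z => (u z.1 * v z.2)%:E)); last exact: integrable_tensor.
rewrite /fubini_F/=.
under eq_integral => x _.
  under eq_integral => y _ do rewrite /= EFinM.
  rewrite integralZl//=.
  over.
have fv : (\int[mu]_x (v x)%:E \is a fin_num)%E by exact: integrable_fin_num.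
have fu : (\int[mu]_x (u x)%:E \is a fin_num)%E by exact: integrable_fin_num.
rewrite -(fineK fv) integralZr//= EFinM; congr (_ * _)%E.
by rewrite /Rintegral fineK.
Qed.

(** Since |K| <= 1 + K^2, a uniform bound on the second moments of a kernel also
    bounds its first moments on a finite measure space. *)
Lemma integrable_weighted_kernel (K : S * T -> R) (f : T -> R) (c : R) :
  measurable_fun setT K -> mu.-integrable setT (EFin \o f) ->
  (forall x, (\int[nu]_s ((K (s, x)) ^+ 2)%:E <= c%:E)%E) ->
  (nu \x mu)%E.-integrable setT (fun z => (f z.2 * K z)%:E).
Proof.
move=> mK intf hc.
have mf : measurable_fun setT f by apply/measurable_EFinP; exact: measurable_int intf.
have mKx x : measurable_fun setT (fun s => K (s, x)).
  exact: measurableT_comp mK (pair2_measurable x).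
have c0 : 0 <= c.
  rewrite -lee_fin; apply: le_trans (hc point).
  by apply: integral_ge0 => s _; rewrite lee_fin sqr_ge0.
apply/integrable21ltyP.
  apply/measurable_EFinP; apply: measurable_funM => //.
  by apply: measurableT_comp mf _; exact: measurable_snd.
apply: (@le_lt_trans _ _ (\int[mu]_x (`|(f x)%:E| * (nu setT + c%:E)))%E); last first.
  have /integrableP[mff iff1] := intf.
  rewrite ge0_integralZr//=.
  - apply: lte_mul_pinfty; first exact: integral_ge0.
      by rewrite ge0_fin_numE; [exact: iff1|exact: integral_ge0].
    by rewrite lte_add_pinfty ?ltry// -ge0_fin_numE// fin_num_measure.
  - by apply/measurable_EFinP; apply: measurableT_comp.
  - by rewrite adde_ge0// lee_fin.
apply: ge0_le_integral => //=.
- by move=> z _; exact: integral_ge0.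
- apply: (measurable_fun_fubini_tonelli_G (abse \o (fun z => (f z.2 * K z)%:E))); last first.
    by move=> z; exact: abse_ge0.
  apply: measurableT_comp => //; apply/measurable_EFinP; apply: measurable_funM => //.
  by apply: measurableT_comp mf _; exact: measurable_snd.
- apply: emeasurable_funM => //; apply/measurable_EFinP; apply: measurableT_comp => //.
- move=> x _.
  under eq_integral => s _ do rewrite normrM EFinM.
  rewrite ge0_integralZl//=; last first.
    by apply/measurable_EFinP; apply: measurableT_comp.
  rewrite lee_wpmul2l//.
  apply: (@le_trans _ _ (\int[nu]_s (1 + (K (s, x) ^+ 2)%:E))%E).
    apply: ge0_le_integral => //=.
    + by apply/measurable_EFinP; apply: measurableT_comp.
    + by apply/measurable_EFinP; apply: measurable_funD => //; apply: measurable_funX.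
    + move=> s _; rewrite lee_fin -(real_normK (num_real (K (s, x)))).
      by set a := `|_|; have := sqr_ge0 (a - 2^-1); nra.
  rewrite ge0_integralD//=.
  + by rewrite integral_cst//= mul1e leeD2l.
  + by move=> s _; rewrite lee_fin sqr_ge0.
  + by apply/measurable_EFinP; apply: measurable_funX.
Qed.

Lemma measurable_weighted_integral (K : S * T -> R) (f : T -> R) (c : R) :
  measurable_fun setT K -> mu.-integrable setT (EFin \o f) ->
  (forall x, (\int[nu]_s ((K (s, x)) ^+ 2)%:E <= c%:E)%E) ->
  measurable_fun setT (fun s => \int[mu]_x (f x * K (s, x))).
Proof.
move=> mK intf hc; rewrite /Rintegral.
have := measurable_fubini_F (integrable_weighted_kernel _ _ _ mK intf hc).
by apply: measurableT_comp.
Qed.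

(** The square of an integral is an integral over T * T, and Fubini's theorem
    then brings the integral over S inside.  The right-hand side depends on K
    only through its second-moment function, so kernels living on different
    spaces but sharing this function have the same mean square. *)
Lemma integral_sqr_Rintegral (K : S * T -> R) (f : T -> R) (c : R) :
  measurable_fun setT K -> mu.-integrable setT (EFin \o f) ->
  (forall x, (\int[nu]_s ((K (s, x)) ^+ 2)%:E <= c%:E)%E) ->
  (\int[nu]_s ((\int[mu]_x (f x * K (s, x)))%R ^+ 2)%:E =
   \int[mu \x mu]_z ((f z.1 * f z.2)%:E *
     \int[nu]_s (K (s, z.1) * K (s, z.2))%:E))%E.
Proof.
move=> mK intf hc.
have mf : measurable_fun setT f by apply/measurable_EFinP; exact: measurable_int intf.
have mKx x : measurable_fun setT (fun s => K (s, x)).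
  exact: measurableT_comp mK (pair2_measurable x).
have c0 : 0 <= c.
  rewrite -lee_fin; apply: le_trans (hc point).
  by apply: integral_ge0 => s _; rewrite lee_fin sqr_ge0.
have intKK x y : nu.-integrable setT (fun s => (K (s, x) * K (s, y))%:E) /\
    (\int[nu]_s `|(K (s, x) * K (s, y))%:E| <= c%:E)%E.
  have le1 : (\int[nu]_s `|(K (s, x) * K (s, y))%:E| <= c%:E)%E.
    have -> : c = 2^-1 * (c + c) by lra.
    apply: (@le_trans _ _ (\int[nu]_s ((2^-1)%:E * (((K (s, x)) ^+ 2)%:E + ((K (s, y)) ^+ 2)%:E)))%E).
      apply: ge0_le_integral => //=.
      - by apply/measurable_EFinP; apply: measurableT_comp => //; exact: measurable_funM.
      - apply/measurable_EFinP; apply: measurable_funM => //.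
        by apply: measurable_funD; apply: measurable_funX.
      - move=> s _; rewrite lee_fin -(real_normK (num_real (K (s, x)))).
        rewrite -(real_normK (num_real (K (s, y)))) normrM.
        set a := `|K (s, x)|; set b := `|K (s, y)|.
        by have := sqr_ge0 (a - b); rewrite sqrrB; nra.
    rewrite ge0_integralZl//=; last 2 first.
    - by apply/measurable_EFinP; apply: measurable_funD; apply: measurable_funX.
    - by move=> s _; rewrite lee_fin addr_ge0 ?sqr_ge0.
    rewrite EFinM lee_pmul2l//.
    rewrite ge0_integralD//= ?EFinD; first exact: leeD.
    - by move=> s _; rewrite lee_fin sqr_ge0.
    - by apply/measurable_EFinP; apply: measurable_funX.
    - by move=> s _; rewrite lee_fin sqr_ge0.
    - by apply/measurable_EFinP; apply: measurable_funX.
  split=> //; apply/integrableP; split; last by rewrite (le_lt_trans le1) ?ltry.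
  by apply/measurable_EFinP; exact: measurable_funM.
have iff := integrable_tensor _ _ intf intf.
pose H (z : S * (T * T)) : \bar R :=
  ((f z.2.1 * f z.2.2) * (K (z.1, z.2.1) * K (z.1, z.2.2)))%:E.
have mH : measurable_fun setT H.
  apply/measurable_EFinP; apply: measurable_funM; apply: measurable_funM.
  - apply: measurableT_comp mf _; apply: measurableT_comp measurable_fst _; exact: measurable_snd.
  - apply: measurableT_comp mf _; apply: measurableT_comp measurable_snd _; exact: measurable_snd.
  - apply: measurableT_comp mK _; apply: measurable_fun_pair; first exact: measurable_fst.
    apply: measurableT_comp measurable_fst _; exact: measurable_snd.
  - apply: measurableT_comp mK _; apply: measurable_fun_pair; first exact: measurable_fst.
    apply: measurableT_comp measurable_snd _; exact: measurable_snd.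
pose mu2 : {sigma_finite_measure set (T * T)%type -> \bar R} := square_measure mu.
have intH : (nu \x mu2)%E.-integrable setT H.
  apply: (integrable21ltyP nu mu2 mH).2.
  apply: (@le_lt_trans _ _ (\int[mu \x mu]_z (`|(f z.1 * f z.2)%:E| * c%:E))%E); last first.
    have /integrableP[mff iff1] := iff.
    rewrite ge0_integralZr//=.
    - apply: lte_mul_pinfty; [exact: integral_ge0| |exact: ltry].
      by rewrite ge0_fin_numE; [exact: iff1|exact: integral_ge0].
    - apply/measurable_EFinP; apply: measurableT_comp => //.
      exact/measurable_EFinP.
  apply: ge0_le_integral => //=.
  - by move=> z _; exact: integral_ge0.
  - apply: (measurable_fun_fubini_tonelli_G (abse \o H)); first exact: measurableT_comp.
    by move=> z; exact: abse_ge0.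
  - apply: emeasurable_funM => //; apply/measurable_EFinP; apply: measurableT_comp => //.
    by apply/measurable_EFinP; have /integrableP[] := iff.
  - move=> z _; rewrite /H /=.
    under eq_integral => s _ do rewrite normrM EFinM.
    rewrite ge0_integralZl//=; last first.
      by apply/measurable_EFinP; apply: measurableT_comp => //; exact: measurable_funM.
    by rewrite lee_wpmul2l//; exact: (intKK z.1 z.2).2.
have iS : nu.-integrable setT (fun s => \int[mu2]_z H (s, z))%E.
  exact: (integrable_fubini_F intH).
transitivity (\int[nu]_s \int[mu2]_z H (s, z))%E; last first.
  rewrite Fubini//; apply: eq_integral => z _; rewrite /H/=.
  under eq_integral => s _ do rewrite EFinM.
  by rewrite integralZl//; exact: (intKK z.1 z.2).1.
have intK1 := integrable_weighted_kernel _ _ _ mK intf hc.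
have := ae_integrable1 intK1 => ae1.
have mY : measurable_fun setT (fun s => ((\int[mu]_x (f x * K (s, x)))%R ^+ 2)%:E : \bar R).
  by apply/measurable_EFinP/measurable_funX; exact: measurable_weighted_integral hc.
apply: ae_eq_integral => //; first exact: measurable_int iS.
apply: filterS ae1 => s is_ _; rewrite /H/=.
rewrite expr2 -integral_tensor//.
by apply: eq_integral => z _; rewrite mulrACA.
Qed.

End second_moment.

(** * Second moments of Gaussian variables *)

Section gaussian_moment.
Context {R : realType}.

(** With w = (x - m)^2 / (4 s^2), the inequality w <= exp w trades the factor
    (x - m)^2 for a Gaussian of twice the variance, which is integrable. *)
Lemma sqr_normal_pdf_le (m s x : R) : s != 0 ->
  x ^+ 2 * normal_pdf m s x <= 2 * m ^+ 2 * normal_pdf m s x +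
    8 * s ^+ 2 * normal_peak s / normal_peak (Num.sqrt 2 * s) *
      normal_pdf m (Num.sqrt 2 * s) x.
Proof.
move=> s0; have s20 : 0 < s ^+ 2 by rewrite exprn_even_gt0.
have s'0 : Num.sqrt 2 * s != 0 by rewrite mulf_neq0// gt_eqF// sqrtr_gt0.
rewrite !normal_pdfE//.
set p := normal_peak s; set p' := normal_peak _.
have p0 : 0 < p by exact: normal_peak_gt0.
have p'0 : 0 < p' by exact: normal_peak_gt0.
rewrite [X in _ <= _ + X](_ : _ = p * (8 * s ^+ 2 * normal_fun m (Num.sqrt 2 * s) x)); last first.
  by field; rewrite gt_eqF.
rewrite [X in X <= _](_ : _ = p * (x ^+ 2 * normal_fun m s x)); last by ring.
rewrite [X in X + _](_ : _ = p * (2 * m ^+ 2 * normal_fun m s x)); last by ring.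
rewrite -mulrDr ler_pM2l//.
have -> : normal_fun m s x = normal_fun m (Num.sqrt 2 * s) x ^+ 2.
  rewrite /normal_fun -expRM_natl; congr expR.
  by rewrite exprMn sqr_sqrtr//; field.
set e := normal_fun _ _ _.
have e0 : 0 < e by exact: expR_gt0.
have le1 : (x - m) ^+ 2 * e <= 4 * s ^+ 2.
  rewrite -ler_pdivlMr//.
  have -> : e^-1 = expR ((x - m) ^+ 2 / (4 * s ^+ 2)).
    rewrite /e /normal_fun -expRN; congr expR.
    by rewrite exprMn sqr_sqrtr//; field.
  rewrite mulrC -ler_pdivrMr; last by rewrite pmulr_rgt0.
  by apply: le_trans (expR_ge1Dx _); rewrite lerDr.
have : x ^+ 2 <= 2 * m ^+ 2 + 2 * (x - m) ^+ 2.
  by rewrite -subr_ge0 (_ : _ - _ = (x - 2 * m) ^+ 2) ?sqr_ge0//; ring.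
move=> le2; apply: (@le_trans _ _ ((2 * m ^+ 2 + 2 * (x - m) ^+ 2) * e ^+ 2)).
  by rewrite ler_pM2r// exprn_gt0.
have := ler_wpM2r (ltW e0) le1; nra.
Qed.

Lemma integral_sqr_normal_prob_lty (m s : R) : s != 0 ->
  (\int[normal_prob m s]_x (x ^+ 2)%:E < +oo)%E.
Proof.
move=> s0.
pose mu := @lebesgue_measure R.
have dom := @normal_prob_dominates R m s.
rewrite -(Radon_Nikodym_SigmaFinite.change_of_variables dom)//=; last 2 first.
- by move=> x; rewrite lee_fin sqr_ge0.
- by apply/measurable_EFinP; exact: measurable_funX.
have fint := Radon_Nikodym_SigmaFinite.f_integrable dom.
have mpdf := @measurable_normal_pdf R m s.
rewrite (_ : integral _ _ _ = \int[mu]_x (x ^+ 2 * normal_pdf m s x)%:E)%E; last first.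
  apply: ae_eq_integral => //.
- apply: emeasurable_funM; last exact: measurable_int fint.
  by apply/measurable_EFinP; exact: measurable_funX.
- by apply/measurable_EFinP; apply: measurable_funM => //; exact: measurable_funX.
- apply: (@ae_eqe_mul2l _ _ _ mu setT _ (fun x => (normal_pdf m s x)%:E)
    (fun x => (x ^+ 2)%:E)); apply: integral_ae_eq => //.
  + exact/measurable_EFinP.
  + by move=> E _ mE; rewrite -(Radon_Nikodym_SigmaFinite.f_integral dom).
have ipdf s' : mu.-integrable setT (fun x => (normal_pdf m s' x)%:E).
  exact: integrable_normal_pdf.
apply: integrable_lty => //.
apply: (le_integrable measurableT _ _
  (integrableD measurableT (integrableZl measurableT (2 * m ^+ 2) (ipdf s))
    (integrableZl measurableT (8 * s ^+ 2 * normal_peak s / normal_peak (Num.sqrt 2 * s))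
       (ipdf (Num.sqrt 2 * s))))).
  by apply/measurable_EFinP; apply: measurable_funM => //; exact: measurable_funX.
move=> x _; rewrite -!EFinM -EFinD !abse_EFin lee_fin ger0_norm; last first.
  by rewrite mulr_ge0 ?sqr_ge0 ?normal_pdf_ge0.
exact: le_trans (sqr_normal_pdf_le _ _ _ s0) (ler_norm _).
Qed.

Context {d : measure_display} {Omega : measurableType d}.
Variable P : probability Omega R.

(** The spectral representation determines covariances through [fine], which
    sends an infinite one to 0; those of Gaussian variables are finite. *)
Lemma gaussian_rv_sqr_lty (X : Omega -> R) :
  measurable_fun setT X -> gaussian_rv P X ->
  (\int[P]_w (X w ^+ 2)%:E < +oo)%E.
Proof.
move=> mX [m [s XE]].
pose X' : {mfun Omega >-> measurableTypeR R} := @mfun_Sub _ _ _ (measurableTypeR R) X (mem_set mX).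
have -> : (\int[P]_w (X w ^+ 2)%:E = \int[distribution P X']_x (x ^+ 2)%:E)%E.
  rewrite ge0_integral_distribution//.
  - by apply/measurable_EFinP; exact: measurable_funX.
  - by move=> x; rewrite lee_fin sqr_ge0.
have [s0|s0] := eqVneq s 0.
- rewrite (@eq_measure_integral _ (measurableTypeR R) _ _ \d_(m : measurableTypeR R)); last first.
    by move=> A mA _; have := XE A mA; rewrite s0 eqxx.
  rewrite integral_dirac//= ?diracT ?mul1e ?ltry//.
  by apply/measurable_EFinP; exact: measurable_funX.
- apply: le_lt_trans (integral_sqr_normal_prob_lty m _ s0).
  rewrite le_eqVlt; apply/orP; left; apply/eqP.
  apply: eq_measure_integral => A mA _.
  by have := XE A mA; rewrite (negbTE s0).
Qed.

End gaussian_moment.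

(** * Mean square convergence to zero implies convergence in distribution *)

Section convergence_in_distribution.
Context {R : realType} {d : measure_display} {Omega : measurableType d}.

(** Monotonicity holds for arbitrary functions, as the integral of a nonnegative
    function is a supremum over the simple functions below it. *)
Lemma le_integral_pointwise (mu : {measure set Omega -> \bar R})
    (f g : Omega -> \bar R) : (forall w, f w <= g w)%E ->
  (\int[mu]_w f w <= \int[mu]_w g w)%E.
Proof.
have ge0_le u v : (forall w, 0 <= u w)%E -> (forall w, u w <= v w)%E ->
    (\int[mu]_w u w <= \int[mu]_w v w)%E.
  move=> u0 uv.
  rewrite !ge0_integralTE//; last by move=> w; exact: le_trans (uv w).
  apply: ereal_sup_le => _ [h hu <-]; exists h => // w.
  exact: le_trans (hu w) (uv w).
move=> fg; rewrite integralE [leRHS]integralE; apply: leeB; apply: ge0_le => // w.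
- by rewrite !funeposE ge_max !le_max fg/= lexx orbT.
- by rewrite !funenegE ge_max !le_max leeN2 fg/= lexx orbT.
Qed.

Variable P : probability Omega R.

(** A bounded continuous g satisfies |g v - g 0| <= e/2 + c sum_j v_j^2 for a
    constant c depending on e: continuity gives the first term near 0, and away
    from 0 the second one dominates the bound of g. *)
Lemma cvg_in_distribution_cst0 (I : Type) (G : set_system I) (FG : Filter G)
    (m : nat) (X : I -> Omega -> 'rV[R]_m) :
  (forall j (e : R), 0 < e -> \forall i \near G,
    measurable_fun setT (fun w => X i w ord0 j) /\
    (\int[P]_w (X i w ord0 j ^+ 2)%:E <= e%:E)%E) ->
  cvg_in_distribution P G X (fun _ => 0).
Proof.
move=> X0 g cg [M gM].
have M0 : 0 <= M by exact: le_trans (gM 0).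
have E0 : ('E_P[g \o (fun _ : Omega => (0 : 'rV[R]_m)%R)] = (g 0)%:E)%E.
  by rewrite unlock /= integral_cst//= probability_setT mule1.
rewrite E0 => {E0}.
suff key (e : R) : 0 < e -> \forall i \near G,
    ((g 0 - e)%:E <= 'E_P[g \o X i] <= (g 0 + e)%:E)%E.
  apply/fine_cvgP; split.
    apply: filterS (key 1 ltr01) => i /andP[le1 le2].
    by rewrite fin_numElt (lt_le_trans _ le1) ?ltNyr// (le_lt_trans le2) ?ltry.
  apply/cvgrPdist_le => e e0; apply: filterS (key e e0) => i /=.
  move: 'E_P[_]%E => [r| |]/=; rewrite ?leeNy_eq ?andbF// !lee_fin => /andP[le1 le2].
  by rewrite ler_distlC; apply/andP; split=> //; lra.
move=> e0.
have e20 : 0 < e / 2 by rewrite divr_gt0.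
have /cvgrPdist_lt/(_ _ e20) /nbhs_ballP[dl /= dl0 gball] :
  g v @[v --> (0 : 'rV[R]_m)] --> g 0 by exact: cg.
pose c := 2 * M / dl ^+ 2.
have c0 : 0 <= c by rewrite divr_ge0 ?sqr_ge0// mulr_ge0.
have gle (v : 'rV[R]_m) : `|g v - g 0| <= e / 2 + \sum_(j < m) c * v ord0 j ^+ 2.
  have S0 : 0 <= \sum_(j < m) c * v ord0 j ^+ 2.
    by apply: sumr_ge0 => j _; rewrite mulr_ge0 ?sqr_ge0.
  have [small|/existsNP[j /negP]] := pselect (forall j, `|v ord0 j| < dl).
    rewrite distrC (le_trans (ltW (gball v _))) ?lerDl//.
    by split=> // i j; rewrite !ord1 /ball/= mxE sub0r normrN.
  rewrite -leNgt => vj.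
  rewrite (bigD1 j)//= (@le_trans _ _ (2 * M))//.
    by rewrite (le_trans (ler_normB _ _))// mulrDl mul1r lerD.
  rewrite (@le_trans _ _ (c * v ord0 j ^+ 2))//; last first.
    rewrite addrCA lerDl addr_ge0 ?(ltW (divr_gt0 _ _))//.
    by apply: sumr_ge0 => i _; rewrite mulr_ge0 ?sqr_ge0.
  rewrite /c -mulrA ler_peMr ?mulr_ge0// mulrC ler_pdivlMr ?exprn_gt0// mul1r.
  by rewrite -[leRHS](real_normK (num_real _)) lerXn2r ?nnegrE// ltW.
pose e' := e / 2 / (m%:R * c + 1).
have d0 : 0 < m%:R * c + 1 by apply: ltr_wpDl => //; rewrite mulr_ge0.
have e'0 : 0 < e' by rewrite !divr_gt0.
have := @filter_forall _ _ _ _ FG (fun j => X0 j e' e'0).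
apply: filterS => i Xi.
have mX j := (Xi j).1; have iX j := (Xi j).2.
pose S w := \sum_(j < m) c * X i w ord0 j ^+ 2.
have S0 w : 0 <= S w by apply: sumr_ge0 => j _; rewrite mulr_ge0 ?sqr_ge0.
have mS : measurable_fun setT S.
  by apply: measurable_sum => j; apply: measurable_funM => //; exact: measurable_funX.
have iS : (\int[P]_w (S w)%:E <= (e / 2)%:E)%E.
  under eq_integral do rewrite /S -sumEFin.
  rewrite ge0_integral_sum//=; last 2 first.
  - by move=> j; apply/measurable_EFinP; apply: measurable_funM => //; exact: measurable_funX.
  - by move=> j w _; rewrite lee_fin mulr_ge0 ?sqr_ge0.
  apply: (@le_trans _ _ (\sum_(j < m) (c * e')%:E)%E).
    apply: lee_sum => j _; under eq_integral do rewrite EFinM.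
    rewrite ge0_integralZl//=.
    - by rewrite [leRHS]EFinM lee_wpmul2l.
    - by apply/measurable_EFinP; exact: measurable_funX.
    - by move=> w _; rewrite lee_fin sqr_ge0.
  rewrite sumEFin lee_fin sumr_const card_ord -[leLHS]mulr_natl.
  rewrite [leLHS](_ : _ = m%:R * c * (e / 2) / (m%:R * c + 1)); last first.
    by rewrite /e'; ring.
  by rewrite ler_pdivrMr// [leRHS]mulrC ler_pM2r// lerDl.
have intS : P.-integrable setT (EFin \o S).
  apply/integrableP; split; first exact/measurable_EFinP.
  under eq_integral do rewrite /= ger0_norm//.
  by rewrite (le_lt_trans iS) ?ltry.
have icst k : P.-integrable setT (EFin \o cst k : Omega -> \bar R).
  exact: finite_measure_integrable_cst.
have Ecst k : (\int[P]_w (EFin \o cst k) w = k%:E)%E.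
  by rewrite /= integral_cst//= probability_setT mule1.
rewrite unlock; apply/andP; split.
- apply: (@le_trans _ _ (\int[P]_w ((EFin \o cst (g 0 - e / 2)%R) \- (EFin \o S)) w)%E).
    rewrite integralB// Ecst.
    rewrite (_ : g 0 - e = (g 0 - e / 2) - e / 2); last by lra.
    by rewrite [leLHS]EFinB leeB.
  apply: le_integral_pointwise => w; rewrite /= -EFinB lee_fin.
  by have := gle (X i w); rewrite ler_distlC -/(S w) => /andP[? ?]; lra.
- apply: (@le_trans _ _ (\int[P]_w ((EFin \o cst (g 0 + e / 2)%R) \+ (EFin \o S)) w)%E); last first.
    rewrite integralD// Ecst.
    rewrite (_ : g 0 + e = (g 0 + e / 2) + e / 2); last by lra.
    by rewrite [leRHS]EFinD leeD.
  apply: le_integral_pointwise => w; rewrite /= -EFinD lee_fin.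
  by have := gle (X i w); rewrite ler_distlC -/(S w) => /andP[? ?]; lra.
Qed.

End convergence_in_distribution.

(** * Spectral isometry *)

Section spectral_moment.
Context {R : realType} {d : measure_display} {Omega : measurableType d}.
Context {P : probability Omega R} {n : nat}.
Implicit Types (x y l : 'rV[R]_n).

(** The kernel of the Hartley transform, a real substitute for exp(it). *)
Definition cas (t : R) : R := cos t + sin t.

Lemma dotrDr l x y : dotr l (x + y) = dotr l x + dotr l y.
Proof. by rewrite /dotr -big_split/=; apply: eq_bigr => i _; rewrite mxE mulrDr. Qed.

Lemma dotrNr l x : dotr l (- x) = - dotr l x.
Proof. by rewrite /dotr -sumrN; apply: eq_bigr => i _; rewrite mxE mulrN. Qed.

Lemma casM (s t : R) : cas s * cas t = cos (s - t) + sin (s + t).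
Proof. by rewrite /cas cosB sinD; ring. Qed.

Lemma measurable_dotr :
  measurable_fun setT (fun p : 'rV[R]_n * 'rV[R]_n => dotr p.1 p.2).
Proof.
apply: measurable_sum => i; apply: measurable_funM.
- by apply: measurableT_comp (measurable_row_coors i) _; exact: measurable_fst.
- by apply: measurableT_comp (measurable_row_coors i) _; exact: measurable_snd.
Qed.

Lemma measurable_dotrl x : measurable_fun setT (fun l => dotr l x).
Proof. exact: measurableT_comp measurable_dotr (pair2_measurable x). Qed.

Lemma measurable_dotrr l : measurable_fun setT (dotr l).
Proof. exact: measurableT_comp measurable_dotr (pair1_measurable l). Qed.

Lemma measurable_cos_dotr x : measurable_fun setT (fun l => cos (dotr l x)).
Proof.
apply: measurableT_comp; last exact: measurable_dotrl.
by apply: continuous_measurable_fun; exact: continuous_cos.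
Qed.

Lemma measurable_sin_dotr x : measurable_fun setT (fun l => sin (dotr l x)).
Proof.
apply: measurableT_comp; last exact: measurable_dotrl.
by apply: continuous_measurable_fun; exact: continuous_sin.
Qed.

Lemma integrable_cos_dotr (F : {finite_measure set 'rV[R]_n -> \bar R}) x :
  F.-integrable setT (fun l => (cos (dotr l x))%:E).
Proof.
apply: measurable_bounded_integrable => //; last 2 first.
- exact: measurable_cos_dotr.
- exists 1; split=> // M M1 l _; apply: le_trans (ltW M1).
  by rewrite ler_norml cos_geN1 cos_le1.
- by rewrite -ge0_fin_numE// fin_num_measure.
Qed.

Lemma integrable_sin_dotr (F : {finite_measure set 'rV[R]_n -> \bar R}) x :
  F.-integrable setT (fun l => (sin (dotr l x))%:E).
Proof.
apply: measurable_bounded_integrable => //; last 2 first.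
- exact: measurable_sin_dotr.
- exists 1; split=> // M M1 l _; apply: le_trans (ltW M1).
  by rewrite ler_norml sin_geN1 sin_le1.
- by rewrite -ge0_fin_numE// fin_num_measure.
Qed.

Variable xi : 'rV[R]_n -> Omega -> R.
Hypotheses (xi_meas : measurable_field xi) (xi_gauss : gaussian_field P xi)
  (xi_mean : zero_mean P xi).
Variable F : {finite_measure set 'rV[R]_n -> \bar R}.
Hypothesis xiF : spectral_measure P xi F.

Lemma measurable_field_at x : measurable_fun setT (xi x).
Proof. exact: measurableT_comp xi_meas (pair2_measurable x). Qed.

Lemma field_sqr_lty x : (\int[P]_w (xi x w ^+ 2)%:E < +oo)%E.
Proof.
apply: gaussian_rv_sqr_lty; first exact: measurable_field_at.
have := xi_gauss 1 (fun _ => x) (fun _ => 1).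
by under eq_fun do rewrite big_ord1 mul1r.
Qed.

Lemma covariance_fieldE x y :
  covariance P (xi x) (xi y) = (\int[P]_w (xi x w * xi y w)%:E)%E.
Proof.
rewrite unlock !xi_mean/= unlock; apply: eq_integral => w _.
by rewrite /= !fctE /= !subr0.
Qed.

Lemma integrable_fieldM x y : P.-integrable setT (fun w => (xi x w * xi y w)%:E).
Proof.
have mM : measurable_fun setT (fun w => xi x w * xi y w).
  by apply: measurable_funM; exact: measurable_field_at.
apply/integrableP; split; first exact/measurable_EFinP.
apply: (@le_lt_trans _ _ (\int[P]_w ((xi x w ^+ 2)%:E + (xi y w ^+ 2)%:E))%E).
  apply: ge0_le_integral => //=.
  - by apply/measurable_EFinP; apply: measurableT_comp.
  - by apply/measurable_EFinP; apply: measurable_funD;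
      apply: measurable_funX; exact: measurable_field_at.
  - move=> w _; rewrite lee_fin -(real_normK (num_real (xi x w))).
    rewrite -(real_normK (num_real (xi y w))) normrM.
    set a := `|xi x w|; set b := `|xi y w|.
    by have := sqr_ge0 (a - b); have := sqr_ge0 (a + b); nra.
rewrite ge0_integralD//=.
- by rewrite lte_add_pinfty// field_sqr_lty.
- by move=> w _; rewrite lee_fin sqr_ge0.
- by apply/measurable_EFinP; apply: measurable_funX; exact: measurable_field_at.
- by move=> w _; rewrite lee_fin sqr_ge0.
- by apply/measurable_EFinP; apply: measurable_funX; exact: measurable_field_at.
Qed.

(** The covariance of a real field is real. *)
Lemma integral_sin_spectral x : \int[F]_l sin (dotr l x) = 0.
Proof. by have := xiF x 0; rewrite /Cintegral/= => -[_ ->]. Qed.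

Lemma integral_fieldM x y :
  (\int[P]_w (xi x w * xi y w)%:E = (\int[F]_l cos (dotr l (x - y)))%R%:E)%E.
Proof.
have := xiF (x - y) y; rewrite addrC subrK covariance_fieldE /Cintegral/= => -[<- _].
by rewrite fineK//; apply: integrable_fin_num => //; exact: integrable_fieldM.
Qed.

(** By [casM] the product is cos<l,x-y> + sin<l,x+y>, and the second term
    integrates to 0. *)
Lemma integral_casM x y :
  (\int[F]_l (cas (dotr l x) * cas (dotr l y))%:E =
   (\int[F]_l cos (dotr l (x - y)))%R%:E)%E.
Proof.
under eq_integral do rewrite casM -dotrNr -!dotrDr EFinD.
rewrite integralD//; last 2 first.
- exact: integrable_cos_dotr.
- exact: integrable_sin_dotr.
have -> : (\int[F]_l (sin (dotr l (x + y)))%:E = 0)%E.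
  rewrite -[LHS]fineK; last by apply: integrable_fin_num => //; exact: integrable_sin_dotr.
  by congr (_%:E); exact: integral_sin_spectral.
rewrite adde0 /Rintegral fineK//.
by apply: integrable_fin_num => //; exact: integrable_cos_dotr.
Qed.

Lemma field_sqr_le x : (\int[P]_w (xi x w ^+ 2)%:E <= (fine (F setT))%:E)%E.
Proof.
under eq_integral do rewrite expr2.
rewrite integral_fieldM subrr lee_fin /Rintegral.
have dot0 l : dotr l 0 = 0 by rewrite /dotr big1// => i _; rewrite mxE mulr0.
under eq_integral do rewrite dot0 cos0.
by rewrite integral_cst// mul1e.
Qed.

(** The isometry of the spectral representation, in real form: the field under P
    and the Hartley kernel under F have the same second-moment function. *)
Lemma integral_sqr_weighted_field (f : 'rV[R]_n -> R) :
  (lebesgue_row R n).-integrable setT (EFin \o f) ->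
  (\int[P]_w ((\int[lebesgue_row R n]_x (f x * xi x w))%R ^+ 2)%:E =
   \int[F]_l ((\int[lebesgue_row R n]_x (f x * cas (dotr l x)))%R ^+ 2)%:E)%E.
Proof.
move=> intf.
have mcas : measurable_fun setT (fun p : 'rV[R]_n * 'rV[R]_n => cas (dotr p.1 p.2)).
  apply: measurable_funD; apply: measurableT_comp measurable_dotr;
    apply: continuous_measurable_fun; [exact: continuous_cos|exact: continuous_sin].
rewrite (@integral_sqr_Rintegral _ _ _ _ _ P (lebesgue_row R n)
  (fun p => xi p.2 p.1) f (fine (F setT)))//; last exact: field_sqr_le.
rewrite (@integral_sqr_Rintegral _ _ _ _ _ F (lebesgue_row R n)
  (fun p => cas (dotr p.1 p.2)) f (fine (F setT)))//; last first.
  move=> x; apply: le_trans (field_sqr_le x).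
  under [leRHS]eq_integral do rewrite expr2.
  rewrite integral_fieldM -integral_casM le_eqVlt; apply/orP; left.
  by apply/eqP/eq_integral.
by apply: eq_integral => z _ /=; rewrite integral_fieldM integral_casM.
Qed.

Lemma fourier_casE (f : 'rV[R]_n -> R) l :
  (lebesgue_row R n).-integrable setT (EFin \o f) ->
  complex.Re (fourier f l) + complex.Im (fourier f l) =
  \int[lebesgue_row R n]_x (f x * cas (dotr l x)).
Proof.
move=> intf; rewrite /fourier /Cintegral/=.
have bd (u : R -> R) : continuous u -> (forall t, `|u t| <= 1) ->
    (lebesgue_row R n).-integrable setT (fun x => (f x * u (dotr l x))%:E).
  move=> cu u1; under eq_fun do rewrite EFinM.
  apply: (@integrableMl _ _ _ _ _ _ (EFin \o f) (fun x => u (dotr l x))) => //.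
  - apply: measurableT_comp; last exact: measurable_dotrr.
    exact: continuous_measurable_fun.
  - by exists 1; split=> // M M1 x _; rewrite /= (le_trans (u1 _))// ltW.
under [X in X + _]eq_Rintegral do rewrite mulr0 subr0 mulrC.
under [X in _ + X]eq_Rintegral do rewrite mulr0 add0r mulrC.
rewrite -RintegralD//.
- by under eq_Rintegral do rewrite -mulrDr.
- by apply: bd; [exact: continuous_cos|move=> t; rewrite ler_norml cos_geN1 cos_le1].
- by apply: bd; [exact: continuous_sin|move=> t; rewrite ler_norml sin_geN1 sin_le1].
Qed.

End spectral_moment.

(** * Weights and layers around a sphere *)

Lemma measurable_sublevel {R : realType} {d} {T : measurableType d} (u : T -> R) (e : R) :
  measurable_fun setT u -> measurable [set l | (u l < e)%R].
Proof.
move=> mu; have := mu measurableT _ (measurable_itv `]-oo, e[).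
by rewrite setTI; congr measurable; apply/seteqP; split=> l /=; rewrite in_itv.
Qed.

Section radius.
Context {R : realType} {n : nat}.

Lemma enorm_ge0 (l : 'rV[R]_n) : 0 <= enorm l.
Proof. exact: sqrtr_ge0. Qed.

Lemma measurable_enorm : measurable_fun setT (@enorm R n).
Proof.
have mdot : measurable_fun setT (fun x : 'rV[R]_n => dotr x x).
  apply: measurable_sum => i.
  by apply: measurable_funM; exact: measurable_row_coors.
apply: measurableT_comp mdot.
by apply: continuous_measurable_fun; exact: sqrt_continuous.
Qed.

Lemma enorm_surj (z : R) : (0 < n)%N -> 0 <= z -> exists l : 'rV[R]_n, enorm l = z.
Proof.
move=> n0 z0; exists (z *: delta_mx ord0 (Ordinal n0)).
rewrite /enorm /dotr (bigD1 (Ordinal n0))//= big1 ?addr0 => [|i /negbTE ni].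
  by rewrite !mxE !eqxx mulr1 -expr2 sqrtr_sqr ger0_norm.
by rewrite !mxE eqxx ni mulr0 mul0r.
Qed.

Lemma measurable_radial_dist (a : R) :
  measurable_fun setT (fun l : 'rV[R]_n => `|enorm l - a|).
Proof.
apply: measurableT_comp => //.
by apply: measurable_funB => //; exact: measurable_enorm.
Qed.

End radius.

Section weights.
Context {R : realType} {n : nat}.

(** The function g is bounded: f 1 is integrable, hence g(|l| - a) is bounded,
    which covers all nonnegative arguments of g, and g is even. *)
Lemma admissible_weights_kernel (a : R) (f : R -> 'rV[R]_n -> R) :
  (0 < n)%N -> 0 <= a -> admissible_weights a f ->
  exists g : R -> R, exists K : R, exists C : R,
  [/\ forall r, 0 < r -> (lebesgue_row R n).-integrable setT (EFin \o f r),
      forall r l, 0 < r -> \int[lebesgue_row R n]_x (f r x * cas (dotr l x)) =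
        r ^+ n * g (r * (enorm l - a)),
      forall s, g s ^+ 2 <= K &
      forall s, s != 0 -> g s ^+ 2 <= C / `|s| ].
Proof.
move=> n0 a0 [f_prop [g [fourierE geven [C gC]]]].
have intf r : 0 < r -> (lebesgue_row R n).-integrable setT (EFin \o f r).
  by move=> r0; have [_ _ /Lfun1_integrable] := f_prop r r0.
have gE r l : 0 < r -> \int[lebesgue_row R n]_x (f r x * cas (dotr l x)) =
    r ^+ n * g (r * (enorm l - a)).
  move=> r0; rewrite -fourier_casE; last exact: intf.
  have rn0 : r ^+ n != 0 by rewrite expf_neq0// gt_eqF.
  have := fourierE r l r0; case: (fourier _ _) => A B /= [].
  rewrite !mul0r subr0 addr0 => <- /eqP.
  rewrite mulf_eq0 invr_eq0 (negbTE rn0)/= => /eqP ->.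
  by rewrite addr0 mulVKf.
pose B := \int[lebesgue_row R n]_x (`|f 1 x| * 2).
have gB s : 0 <= s -> `|g s| <= B.
  move=> s0; have [l lE] := enorm_surj (s + a) n0 (addr_ge0 s0 a0).
  have -> : g s = \int[lebesgue_row R n]_x (f 1 x * cas (dotr l x)).
    by rewrite gE// expr1n mul1r mul1r lE addrK.
  have mcas : measurable_fun setT (fun x => cas (dotr l x)).
    apply: measurable_funD.
      exact: measurableT_comp (continuous_measurable_fun (@continuous_cos R)) (measurable_dotrr l).
    exact: measurableT_comp (continuous_measurable_fun (@continuous_sin R)) (measurable_dotrr l).
  have cas2 t : `|cas t| <= 2 :> R.
    rewrite (le_trans (ler_normD _ _))// (_ : 2 = 1 + 1)//.
    by rewrite lerD// ler_norml ?cos_geN1 ?cos_le1 ?sin_geN1 ?sin_le1.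
  have mf1 : measurable_fun setT (f 1).
    by apply/measurable_EFinP; exact: measurable_int (intf 1 ltr01).
  have int2 : (lebesgue_row R n).-integrable setT (EFin \o (fun x => `|f 1 x| * 2)).
    have := integrableZl measurableT 2 (integrable_norm (intf 1 ltr01)).
    by apply: eq_integrable => // x _; rewrite /= mulrC EFinM.
  have intcas : (lebesgue_row R n).-integrable setT
      (EFin \o (fun x => f 1 x * cas (dotr l x))).
    apply: (le_integrable measurableT _ _ int2).
      by apply/measurable_EFinP; exact: measurable_funM.
    move=> x _ /=; rewrite lee_fin normrM [leRHS]ger0_norm ?mulr_ge0//.
    by rewrite ler_wpM2l.
  apply: le_trans (le_normr_Rintegral measurableT intcas) _.
  apply: le_Rintegral => //.
    exact: integrable_norm intcas.
  by move=> x _; rewrite normrM ler_wpM2l.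
exists g, (B ^+ 2), C; split=> // [s|s s0].
- have [s0|/ltW s0] := leP 0 s.
    by rewrite -(real_normK (num_real (g s))) lerXn2r ?nnegrE ?(le_trans _ (gB s s0)) ?gB.
  rewrite -geven; have s0' : 0 <= - s by rewrite oppr_ge0.
  by rewrite -(real_normK (num_real (g _))) lerXn2r ?nnegrE ?(le_trans _ (gB _ s0')) ?gB.
- have [sp|sn] := ltP 0 s; first by rewrite gtr0_norm// gC.
  by rewrite ler0_norm// -geven gC// oppr_gt0 lt_neqAle s0.
Qed.

End weights.

Section layers.
Context {R : realType}.
Variables (K C delta : R).
Hypotheses (K0 : 0 <= K) (C0 : 0 <= C) (delta0 : 0 < delta).

(** On the layer delta/v^(j+1) <= u < delta/v^j the second bound on y is at most
    C v^(j+1) / (s delta); the first bound on y serves in the innermost ball. *)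
Lemma layer_pointwise (N : nat) (v s u y : R) : 0 < v -> 0 < s -> 0 <= u ->
  y <= K -> (u != 0 -> y <= C / (s * u)) ->
  y <= C / (s * delta) +
    \sum_(j < N) C * v ^+ j.+1 / (s * delta) * (u < delta / v ^+ j)%R%:R +
    K * (u < delta / v ^+ N)%R%:R.
Proof.
move=> v0 s0 u0 yK yC.
have sd0 : 0 < s * delta by rewrite mulr_gt0.
have yle e : 0 < e -> e <= u -> y <= C / (s * e).
  move=> e0 eu; apply: le_trans (yC _) _; first by rewrite gt_eqF// (lt_le_trans e0).
  by rewrite ler_wpM2l// lef_pV2 ?ler_pM2l// posrE mulr_gt0// (lt_le_trans e0).
have S0 m : 0 <= \sum_(j < m) C * v ^+ j.+1 / (s * delta) * (u < delta / v ^+ j)%R%:R.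
  by apply: sumr_ge0 => j _; rewrite !mulr_ge0 ?exprn_ge0 ?invr_ge0 ?(ltW v0) ?(ltW sd0).
elim: N => [|N IH].
  rewrite big_ord0 addr0 expr0 divr1; have [ud|du] := ltP u delta.
    by rewrite mulr1 (le_trans yK)// lerDr divr_ge0 ?(ltW sd0).
  by rewrite mulr0 addr0 yle.
have [uN1|N1u] := ltP u (delta / v ^+ N.+1).
  by rewrite mulr1 (le_trans yK)// lerDr addr_ge0 ?S0// divr_ge0// ltW.
rewrite mulr0 addr0 big_ord_recr/= addrA; move: IH.
have [uN|Nu] := ltP u (delta / v ^+ N); last by rewrite !mulr0.
rewrite !mulr1 => _.
have vN0 : 0 < v ^+ N.+1 by rewrite exprn_gt0.
apply: (@le_trans _ _ (C * v ^+ N.+1 / (s * delta))); last first.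
  by rewrite lerDr addr_ge0 ?S0// divr_ge0// ltW.
rewrite (_ : _ / _ = C / (s * (delta / v ^+ N.+1))); first by rewrite yle// divr_gt0.
by field; rewrite !gt_eqF.
Qed.

Context {d} {T : measurableType d}.
Variables (F : {finite_measure set T -> \bar R}) (u : T -> R) (D : R).
Hypotheses (umeas : measurable_fun setT u) (u0 : forall l, 0 <= u l) (D0 : 0 <= D)
  (FD : forall e, 0 < e <= delta -> (F [set l | (u l < e)%R] <= (D * e)%:E)%E).

(** The measure D delta/v^j of the j-th ball compensates the factor v^(j+1) up to
    one power of v, so that each of the N layers contributes C D v/s. *)
Lemma layer_integral (N : nat) (v s : R) (y : T -> R) : 1 <= v -> s = v ^+ N ->
  (forall l, y l <= K) -> (forall l, u l != 0 -> y l <= C / (s * u l)) ->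
  (\int[F]_l (y l)%:E <=
    ((C * fine (F setT) / delta + N%:R * (C * D) + K * D * delta) * v / s)%:E)%E.
Proof.
move=> v1 sE yK yC.
have v0 : 0 < v by exact: lt_le_trans v1.
have vX0 j : 0 < v ^+ j by rewrite exprn_gt0.
have vX1 j : 1 <= v ^+ j by rewrite exprn_ege1.
have s0 : 0 < s by rewrite sE.
have sd0 : 0 < s * delta by rewrite mulr_gt0.
have mlt e : measurable [set l | (u l < e)%R] by exact: measurable_sublevel.
have F0 : 0 <= fine (F setT) by rewrite fine_ge0.
pose c j := C * v ^+ j.+1 / (s * delta).
have c0 j : 0 <= c j by rewrite !mulr_ge0 ?exprn_ge0 ?invr_ge0 ?(ltW v0) ?(ltW sd0).
pose A j := [set l | (u l < delta / v ^+ j)%R].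
have FA j : (F (A j) <= (D * (delta / v ^+ j))%:E)%E.
  by rewrite FD// divr_gt0//= ler_pdivrMr// ler_peMr// ltW.
have mA j : measurable (A j) by exact: mlt.
have ind k B : 0 <= k -> measurable B ->
    (\int[F]_l (k%:E * (\1_B l)%:E) = k%:E * F B)%E.
  move=> k0 mB; rewrite ge0_integralZl//=; first by rewrite integral_indic// setIT.
  by apply/measurable_EFinP; exact: measurable_indic.
apply: (@le_trans _ _ (\int[F]_l ((C / (s * delta))%:E * (\1_setT l)%:E +
   (\sum_(j < N) (c j)%:E * (\1_(A j) l)%:E + K%:E * (\1_(A N) l)%:E)))%E).
  apply: le_integral_pointwise => l.
  rewrite indicT /cst -!EFinM; under eq_bigr do rewrite -EFinM.
  rewrite sumEFin -!EFinD lee_fin mulr1 addrA.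
  have indE j : \1_(A j) l = (u l < delta / v ^+ j)%R%:R :> R.
    rewrite indicE (_ : (l \in A j) = (u l < delta / v ^+ j))//.
    by apply/idP/idP; rewrite inE.
  under eq_bigr do rewrite indE.
  by rewrite indE; apply: layer_pointwise => //; exact: yC.
have mind (k : R) (B : set T) : measurable B -> measurable_fun setT (fun l => (k%:E * (\1_B l)%:E)%E).
  move=> mB; apply: measurable_funeM.
  by apply/measurable_EFinP; exact: measurable_indic.
rewrite ge0_integralD//=; last 4 first.
- by move=> l _; rewrite mule_ge0// lee_fin divr_ge0 ?(ltW sd0).
- exact: mind.
- move=> l _; rewrite adde_ge0//; last by rewrite mule_ge0// lee_fin.
  by apply: sume_ge0 => j _; rewrite mule_ge0// lee_fin.
- apply: emeasurable_funD; last exact: mind.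
  by apply: emeasurable_sum => j; exact: mind.
rewrite ge0_integralD//=; last 4 first.
- by move=> l _; apply: sume_ge0 => j _; rewrite mule_ge0// lee_fin.
- by apply: emeasurable_sum => j; exact: mind.
- by move=> l _; rewrite mule_ge0// lee_fin.
- exact: mind.
rewrite ge0_integral_sum//=; last 2 first.
- by move=> j; exact: mind.
- by move=> j l _; rewrite mule_ge0// lee_fin.
rewrite !ind ?divr_ge0 ?(ltW sd0)//.
under eq_bigr do rewrite ind//.
apply: (@le_trans _ _ ((C / (s * delta) * fine (F setT))%:E +
   (\sum_(j < N) (c j * (D * (delta / v ^+ j)))%:E +
     (K * (D * (delta / v ^+ N)))%:E))%E).
  apply: leeD; first by rewrite [leRHS]EFinM fineK// fin_num_measure.
  apply: leeD; last by rewrite [leRHS]EFinM lee_wpmul2l.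
  by apply: lee_sum => j _; rewrite [leRHS]EFinM lee_wpmul2l// lee_fin.
rewrite sumEFin -!EFinD lee_fin.
have -> : \sum_(j < N) c j * (D * (delta / v ^+ j)) = N%:R * (C * D) * v / s.
  rewrite (eq_bigr (fun _ => C * D * v / s)) => [|j _].
    by rewrite sumr_const card_ord -[LHS]mulr_natl; ring.
  by rewrite /c exprS; field; rewrite !gt_eqF.
rewrite -sE addrA.
have -> : (C * fine (F setT) / delta + N%:R * (C * D) + K * D * delta) * v / s =
  (C * fine (F setT) / delta) / s * v + N%:R * (C * D) * v / s + (K * D * delta / s) * v by ring.
apply: lerD; first (apply: lerD => //).
- rewrite (_ : C / (s * delta) * _ = C * fine (F setT) / delta / s); last first.
    by field; rewrite !gt_eqF.
  by rewrite ler_peMr// !mulr_ge0// invr_ge0 ltW.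
- rewrite (_ : K * (D * _) = K * D * delta / s); last by ring.
  by rewrite ler_peMr// !mulr_ge0// ?invr_ge0 ltW.
Qed.

End layers.

(** * Spectral measure near a regular radius *)

Section spectral_density.
Context {R : realType} {n : nat}.

Lemma singularities_apart (k : nat) (a_ : nat -> R) (a : R) :
  (forall i, (i < k)%N -> a != a_ i) ->
  exists2 delta : R, 0 < delta & forall i, (i < k)%N -> 2 * delta <= `|a - a_ i|.
Proof.
elim: k => [|k IH] aN; first by exists 1.
have [|e e0 eP] := IH; first by move=> i ik; exact/aN/ltnW.
have ak : 0 < `|a - a_ k| by rewrite normr_gt0 subr_eq0 aN.
exists (Num.min e (`|a - a_ k| / 2)); first by rewrite lt_min e0 divr_gt0.
move=> i; rewrite ltnS leq_eqVlt => /predU1P[->|ik].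
- have : Num.min e (`|a - a_ k| / 2) <= `|a - a_ k| / 2 by rewrite ge_min lexx orbT.
  lra.
- have : Num.min e (`|a - a_ k| / 2) <= e by rewrite ge_min lexx.
  by have := eP i ik; lra.
Qed.

(** At distance at least delta from all the a_i, every singular factor is at most
    its value at distance delta.  As a_0 = 0, this includes the power of |l|. *)
Lemma spectral_density_bounded_near (phi : R -> R) (k : nat) (a_ alpha_ : nat -> R)
    (h : R -> R) (a : R) : (0 < n)%N -> (0 < k)%N -> a_ 0%N = 0 ->
  alpha_ 0%N < n%:R ->
  (forall i, (1 <= i)%N -> (i < k)%N -> alpha_ i < 1) ->
  (forall l : 'rV[R]_n, (forall i, (i < k)%N -> enorm l != a_ i) ->
    phi (enorm l) = h (enorm l) / enorm l `^ (n%:R - alpha_ 0%N) *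
      \prod_(1 <= i < k) (`|enorm l - a_ i| `^ (1 - alpha_ i))^-1) ->
  (forall z, 0 <= z -> 0 <= h z) ->
  (exists M : R, forall z, 0 <= z -> h z <= M) ->
  0 <= a -> (forall i, (i < k)%N -> a != a_ i) ->
  exists delta : R, exists M : R, [/\ 0 < delta, delta < a, 0 <= M &
    forall z, `|z - a| <= delta -> phi z <= M].
Proof.
move=> n0 k0 a_0 al0 al1 phiE h0 [Mh hM] a0 aN.
have [delta d0 dP] := singularities_apart k a_ a aN.
have da : 2 * delta <= a by have := dP 0%N k0; rewrite a_0 subr0 ger0_norm.
have Mh0 : 0 <= Mh by exact: le_trans (h0 0 _) (hM 0 _).
have pow_le p t : 0 <= p -> delta <= t -> (t `^ p)^-1 <= (delta `^ p)^-1.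
  move=> p0 dt; have t0 : 0 < t by exact: lt_le_trans dt.
  rewrite lef_pV2 ?posrE ?powR_gt0//.
  by apply: ge0_ler_powR => //; rewrite nnegrE ltW.
exists delta, (Mh / delta `^ (n%:R - alpha_ 0%N) *
  \prod_(1 <= i < k) (delta `^ (1 - alpha_ i))^-1); split=> //.
- lra.
- by rewrite mulr_ge0 ?divr_ge0 ?powR_ge0// prodr_ge0// => i _; rewrite invr_ge0 powR_ge0.
move=> z; rewrite ler_distlC => /andP[z1 z2].
have dz : delta <= z by lra.
have z0 : 0 <= z by lra.
have apart i : (i < k)%N -> delta <= `|z - a_ i|.
  move=> /dP; have := ler_distD z a (a_ i); rewrite (distrC a z).
  have : `|z - a| <= delta by rewrite ler_distlC z1 z2.
  lra.
have [l lz] := enorm_surj z n0 z0.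
rewrite -lz phiE lz; last first.
  by move=> i /apart; apply: contraTneq => ->; rewrite subrr normr0 -ltNge.
have inv0 (x p : R) : 0 <= (x `^ p)^-1 by rewrite invr_ge0 powR_ge0.
apply: ler_pM.
- by rewrite mulr_ge0 ?h0.
- by apply: prodr_ge0.
- by apply: ler_pM => //; [exact: h0|exact: hM|apply: pow_le => //; lra].
- rewrite big_nat_cond [leRHS]big_nat_cond; apply: ler_prod => i.
  move=> /andP[/andP[i1 ik] _]; rewrite inv0/= pow_le ?apart//.
  by rewrite subr_ge0 ltW// al1.
Qed.

(** The measure of a shell is an increment of the spectral function, that is an
    integral of z^(n-1) phi(z) over an interval of length 2e around a. *)
Lemma spectral_shell_le (F : {finite_measure set 'rV[R]_n -> \bar R})
    (phi : R -> R) (c a delta M : R) :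
  (forall z, 0 <= z -> 0 <= phi z) ->
  lebesgue_measure.-integrable `[0, +oo[ (fun z => (z ^+ n.-1 * phi z)%:E) ->
  (forall u, 0 <= u -> spectral_function F u =
    c * \int[lebesgue_measure]_(z in `[0, u]) (z ^+ n.-1 * phi z)) ->
  0 < delta -> delta < a -> (forall z, `|z - a| <= delta -> phi z <= M) ->
  forall e, 0 < e <= delta ->
    (F [set l | (`|enorm l - a| < e)%R] <=
      (`|c| * ((2 * a) ^+ n.-1 * M * 2) * e)%:E)%E.
Proof.
move=> phi0 intphi FE d0 da phiM e /andP[e0 ed].
have mlt u : measurable [set l : 'rV[R]_n | (enorm l < u)%R].
  by apply: measurable_sublevel; exact: measurable_enorm.
pose I := fun u => \int[lebesgue_measure]_(z in `[0, u]) (z ^+ n.-1 * phi z).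
have FI u : 0 <= u -> F [set l : 'rV[R]_n | (enorm l < u)%R] = (c * I u)%:E.
  by move=> u0; rewrite /I -FE// /spectral_function fineK// fin_num_measure.
have intS (i : interval R) : [set` i] `<=` `[0, +oo[ ->
    lebesgue_measure.-integrable [set` i] (EFin \o (fun z => z ^+ n.-1 * phi z)).
  by move=> sub; apply: integrableS intphi.
have sub0 x y : [set` Interval (BRight x) y] `<=` [set` Interval (BLeft x) y].
  by move=> z /=; rewrite !in_itv/= => /andP[/ltW -> ->].
apply: (@le_trans _ _ (F ([set l | (enorm l < a + e)%R] `\` [set l | (enorm l < a - e)%R]))).
  apply: le_measure; rewrite ?inE.
  - by apply: measurable_sublevel; exact: measurable_radial_dist.
  - exact: measurableD.
  - move=> l /=; rewrite ltr_distl => /andP[l1 l2]; split=> //.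
    by apply/negP; rewrite -leNgt ltW.
have -> : (F ([set l | (enorm l < a + e)%R] `\` [set l | (enorm l < a - e)%R]) =
    (c * I (a + e))%:E - (c * I (a - e))%:E)%E.
  rewrite measureD//; last by rewrite -ge0_fin_numE// fin_num_measure.
  congr (_ - _)%E; first by apply: FI; lra.
  rewrite setIC (_ : _ `&` _ = [set l | (enorm l < a - e)%R]); first by apply: FI; lra.
  by apply/setIidPl => l /= /lt_trans; apply; lra.
rewrite -EFinB lee_fin -mulrBr.
rewrite (_ : I (a + e) - I (a - e) =
    \int[lebesgue_measure]_(z in `]a - e, a + e]) (z ^+ n.-1 * phi z)); last first.
  rewrite /I Rintegral_itvB//=.
  - by apply: intS => z /=; rewrite !in_itv/= andbT => /andP[].
  - by rewrite bnd_simp; lra.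
  - by rewrite bnd_simp; lra.
have J0 : 0 <= \int[lebesgue_measure]_(z in `]a - e, a + e]) (z ^+ n.-1 * phi z).
  apply: Rintegral_ge0 => z /=; rewrite in_itv/= => /andP[z1 z2].
  have z0 : 0 <= z by lra.
  by apply: mulr_ge0; [exact: exprn_ge0|exact: phi0].
apply: (@le_trans _ _ (`|c| * \int[lebesgue_measure]_(z in `]a - e, a + e]) (z ^+ n.-1 * phi z))).
  by rewrite ler_wpM2r// ler_norm.
rewrite -mulrA ler_wpM2l//.
apply: (@le_trans _ _ (\int[lebesgue_measure]_(z in `]a - e, a + e]) ((2 * a) ^+ n.-1 * M))).
  apply: le_Rintegral => //=.
  - by apply: intS => z /=; rewrite !in_itv/= andbT => /andP[z1 _]; lra.
  - apply: measurable_bounded_integrable => //=.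
    + rewrite lebesgue_measure_itv/= lte_fin; case: ifP => _; last by rewrite ltry.
      by rewrite -EFinB ltry.
    + by exists `|(2 * a) ^+ n.-1 * M|; split=> // m /ltW + z _.
  - move=> z; rewrite in_itv/= => /andP[z1 z2]; have z0 : 0 <= z by lra.
    apply: ler_pM; rewrite ?exprn_ge0 ?phi0//.
      by rewrite lerXn2r ?nnegrE//; lra.
    by apply: phiM; rewrite ler_distlC; lra.
rewrite Rintegral_cst//= lebesgue_measure_itv/= lte_fin.
rewrite ifT; last by lra.
by rewrite -EFinB/= le_eqVlt; apply/orP; left; apply/eqP; ring.
Qed.

End spectral_density.

(** * Decay of the weighted process *)

Section decay.
Context {R : realType}.

Lemma near_powRN_le (B beta e : R) : 0 <= B -> 0 < beta -> 0 < e ->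
  \forall r \near +oo, B * r `^ (- beta) <= e.
Proof.
move=> B0 b0 e0.
near=> r.
have r0 : 0 < r by near: r; exact: nbhs_pinfty_gt.
have rb : (B / e) `^ beta^-1 <= r by near: r; exact: nbhs_pinfty_ge.
rewrite powRN ler_pdivrMr ?powR_gt0// mulrC -ler_pdivrMr//.
have := ge0_ler_powR (ltW b0) _ _ rb; rewrite !nnegrE powR_ge0 (ltW r0).
move=> /(_ isT isT); rewrite -powRrM mulVf ?gt_eqF// powRr1//.
by rewrite divr_ge0// ltW.
Unshelve. all: by end_near. Qed.

(** The powers of r brought by the normalization, the scaling of the weights and
    the layer bound v/s at s = rt, v = s^(1/N), collected. *)
Lemma normalized_powR (n N : nat) (alpha r t : R) : (0 < N)%N -> 0 < r -> 0 < t ->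
  (r `^ (n%:R - alpha / 2))^-1 ^+ 2 * ((r * t) ^+ n) ^+ 2 *
    ((r * t) `^ N%:R^-1 / (r * t)) =
  (t ^+ n) ^+ 2 * (t `^ N%:R^-1 / t) * r `^ (- (1 - alpha - N%:R^-1)).
Proof.
move=> N0 r0 t0.
rewrite powRM ?ltW// exprMn invfM.
have -> : r `^ (- (1 - alpha - N%:R^-1)) =
    (r `^ (n%:R - alpha / 2))^-1 ^+ 2 * (r ^+ n) ^+ 2 * (r `^ N%:R^-1 / r).
  rewrite -powRN -(powR_inv1 (ltW r0)) -(powR_mulrn _ (ltW r0)) !expr2.
  have rD x y : r `^ x * r `^ y = r `^ (x + y).
    by rewrite powRD// (gt_eqF r0) implybT.
  by rewrite !rD; congr (_ `^ _); lra.
by ring.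
Qed.

End decay.

Section weighted.
Context {R : realType} {d : measure_display} {Omega : measurableType d}.
Context {P : probability Omega R} {n : nat}.

(** The constant B does not depend on r: all of r is in the explicit power, whose
    exponent is negative as soon as 1/N < 1 - alpha. *)
Lemma weighted_process_moment_le (xi : 'rV[R]_n -> Omega -> R)
    (f : R -> 'rV[R]_n -> R) (a : R) (F : {finite_measure set 'rV[R]_n -> \bar R})
    (delta D : R) :
  (0 < n)%N -> 0 <= a -> measurable_field xi -> gaussian_field P xi ->
  zero_mean P xi -> spectral_measure P xi F -> admissible_weights a f ->
  0 < delta -> 0 <= D ->
  (forall e, 0 < e <= delta ->
    (F [set l | (`|enorm l - a| < e)%R] <= (D * e)%:E)%E) ->
  forall N : nat, (0 < N)%N -> exists2 B : R, 0 <= B &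
    forall alpha r t, 0 < r -> 0 < t -> 1 <= r * t ->
      measurable_fun setT (weighted_process f xi alpha r t) /\
      (\int[P]_w (weighted_process f xi alpha r t w ^+ 2)%:E <=
       (B * ((t ^+ n) ^+ 2 * (t `^ N%:R^-1 / t)) * r `^ (- (1 - alpha - N%:R^-1)))%:E)%E.
Proof.
move=> n0 a0 xi_meas xi_gauss xi_mean xiF f_adm d0 D0 FD N N0.
have [g [K [C [intf fg gK gC]]]] := admissible_weights_kernel a f n0 a0 f_adm.
have K0 : 0 <= K by exact: le_trans (sqr_ge0 _) (gK 0).
have C0 : 0 <= C.
  by have := le_trans (sqr_ge0 _) (gC 1 (oner_neq0 _)); rewrite normr1 divr1.
pose B := C * fine (F setT) / delta + N%:R * (C * D) + K * D * delta.
have B0 : 0 <= B.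
  have F0 : 0 <= fine (F setT) by rewrite fine_ge0.
  have dV0 : 0 <= delta^-1 by rewrite invr_ge0 ltW.
  by rewrite /B !addr_ge0 ?mulr_ge0// ltW.
exists B => // alpha r t r0 t0 rt1.
have s0 : 0 < r * t by rewrite mulr_gt0.
pose J w := \int[lebesgue_row R n]_x (f (r * t) x * xi x w).
have mJ : measurable_fun setT J.
  apply: (@measurable_weighted_integral _ _ _ _ _ P (lebesgue_row R n)
    (fun p => xi p.2 p.1) _ (fine (F setT))) => //; first exact: intf.
  exact: field_sqr_le.
have -> : weighted_process f xi alpha r t =
    (fun w => (r `^ (n%:R - alpha / 2))^-1 * J w).
  by apply/funext => w; rewrite /weighted_process gt_eqF.
split; first exact: measurable_funM.
under eq_integral do rewrite exprMn EFinM.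
rewrite ge0_integralZl//=; last 3 first.
- by apply/measurable_EFinP; exact: measurable_funX.
- by move=> w _; rewrite lee_fin sqr_ge0.
- by rewrite lee_fin sqr_ge0.
rewrite (integral_sqr_weighted_field xi xi_meas xi_gauss xi_mean F xiF); last exact: intf.
pose v := (r * t) `^ N%:R^-1.
have Nn0 : N%:R != 0 :> R by rewrite pnatr_eq0 -lt0n.
have vN : r * t = v ^+ N.
  by rewrite /v -powR_mulrn ?powR_ge0// -powRrM mulVf// powRr1// ltW.
have v1 : 1 <= v.
  have <- : 1 `^ N%:R^-1 = 1 :> R by rewrite powR1.
  by apply: ge0_ler_powR; rewrite ?nnegrE ?invr_ge0 ?(ltW s0).
have -> : B * ((t ^+ n) ^+ 2 * (t `^ N%:R^-1 / t)) * r `^ (- (1 - alpha - N%:R^-1)) =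
    (r `^ (n%:R - alpha / 2))^-1 ^+ 2 * (((r * t) ^+ n) ^+ 2 * (B * v / (r * t))).
  by rewrite -mulrA -normalized_powR// -/v; ring.
rewrite [leRHS]EFinM; apply: lee_wpmul2l; first by rewrite lee_fin sqr_ge0.
under eq_integral do rewrite fg// exprMn.
(* The factor S goes into the constants K and C, in which the layer bound is
   linear. *)
set S := ((r * t) ^+ n) ^+ 2; have S0 : 0 <= S by rewrite sqr_ge0.
have := @layer_integral R (S * K) (S * C) delta (mulr_ge0 S0 K0) (mulr_ge0 S0 C0) d0
  _ _ F (fun l => `|enorm l - a|) D (measurable_radial_dist a)
  (fun l => normr_ge0 _) D0 FD N v (r * t)
  (fun l => S * g (r * t * (enorm l - a)) ^+ 2) v1 vN.
move=> /(_ _ _)/le_trans; apply.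
- by move=> l; rewrite /= ler_wpM2l.
- move=> l l0; rewrite /= -[leRHS]mulrA ler_wpM2l//.
  have /gC : r * t * (enorm l - a) != 0.
    by rewrite mulf_neq0 ?(gt_eqF s0)// -normr_eq0.
  by rewrite normrM (gtr0_norm s0).
- by rewrite lee_fin le_eqVlt; apply/orP; left; apply/eqP; rewrite /B; ring.
Qed.

End weighted.

Theorem theorem5p1 (R : realType) (d : measure_display) (Omega : measurableType d)
  (P : probability Omega R) (n : nat) (hn : (1 <= n)%N)
  (xi : 'rV[R]_n -> Omega -> R)
  (xi_meas : measurable_field xi)
  (xi_cont : mean_square_continuous P xi)
  (xi_hi : homogeneous_isotropic P xi)
  (xi_gauss : gaussian_field P xi)
  (xi_mean : zero_mean P xi)
  (phi : R -> R) (xi_phi : isotropic_spectral_density P xi phi)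
  (k : nat) (hk : (1 <= k)%N) (a_ alpha_ : nat -> R) (h : R -> R)
  (a_0 : a_ 0%N = 0)
  (a_incr : forall i j, (i < j)%N -> (j < k)%N -> a_ i < a_ j)
  (alpha_0 : 0 < alpha_ 0%N < n%:R)
  (alpha_i : forall i, (1 <= i)%N -> (i < k)%N -> 0 < alpha_ i < 1)
  (phiE : forall l : 'rV[R]_n, (forall i, (i < k)%N -> enorm l != a_ i) ->
    phi (enorm l) = h (enorm l) / enorm l `^ (n%:R - alpha_ 0%N) *
      \prod_(1 <= i < k) (`|enorm l - a_ i| `^ (1 - alpha_ i))^-1)
  (phi_L1 : (fun l : 'rV[R]_n => phi (enorm l)) \in Lfun (lebesgue_row R n) 1)
  (h_ge0 : forall z : R, 0 <= z -> 0 <= h z)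
  (h_bounded : exists M : R, forall z : R, 0 <= z -> h z <= M)
  (h_cont : forall i, (i < k)%N -> exists2 e : R, 0 < e &
    {within `[0, +oo[ `&` ball (a_ i) e, continuous h})
  (h_neq0 : forall i, (i < k)%N -> h (a_ i) != 0)
  (a : R) (a_ge0 : 0 <= a) (a_notin : forall i, (i < k)%N -> a != a_ i)
  (f : R -> 'rV[R]_n -> R) (f_adm : admissible_weights a f)
  (alpha : R) (halpha : 0 < alpha < 1) :
  cvg_fdd P (pinfty_nbhs R) `[0, 1] (weighted_process f xi alpha) (fun _ => cst 0).
Proof.
move=> m t tI.
have -> : (fun w : Omega => \row_(j < m) (fun=> cst 0) (t j) w) = (fun _ => 0 : 'rV[R]_m).
  by apply/funext => w; apply/rowP => j; rewrite !mxE.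
case: xi_phi => phi_ge0 phi_int [F xiF FE].
have [delta [M [delta0 delta_a M0 phiM]]] := spectral_density_bounded_near phi k
  a_ alpha_ h a hn hk a_0 (proj2 (andP alpha_0))
  (fun i i1 ik => proj2 (andP (alpha_i i i1 ik))) phiE h_ge0 h_bounded a_ge0 a_notin.
have shell := spectral_shell_le F phi _ a delta M phi_ge0 phi_int FE delta0 delta_a phiM.
pose c : R := 2 * pi `^ (n%:R / 2) / Gamma (n%:R / 2).
have D0 : 0 <= `|c| * ((2 * a) ^+ n.-1 * M * 2) by rewrite !mulr_ge0// exprn_ge0// mulr_ge0.
have /andP[alpha0 alpha1] := halpha.
(* N layers, with 1/N < 1 - alpha. *)
pose N := (Num.bound (1 - alpha)^-1).
have NE : (1 - alpha)^-1 < N%:R.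
  by apply: archi_boundP; rewrite invr_ge0 subr_ge0 ltW.
have N0R : 0 < N%:R :> R by apply: le_lt_trans NE; rewrite invr_ge0 subr_ge0 ltW.
have N0 : (0 < N)%N by rewrite -(ltr0n R).
have beta0 : 0 < 1 - alpha - N%:R^-1.
  by rewrite subr_gt0 -(invrK (1 - alpha)) ltf_pV2// posrE invr_gt0 subr_gt0.
have [B B0 moment] := weighted_process_moment_le xi f a F delta _ hn a_ge0 xi_meas
  xi_gauss xi_mean xiF f_adm delta0 D0 shell N N0.
apply: cvg_in_distribution_cst0 => j e e0.
have /andP[t0 t1] : 0 <= t j <= 1 by have := tI j; rewrite /= in_itv.
have XE r : (fun w => (\row_(i < m) weighted_process f xi alpha r (t i) w) ord0 j) =
    weighted_process f xi alpha r (t j) by apply/funext => w; rewrite mxE.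
suff : \forall r \near +oo, measurable_fun setT (weighted_process f xi alpha r (t j)) /\
    (\int[P]_w (weighted_process f xi alpha r (t j) w ^+ 2)%:E <= e%:E)%E.
  by apply: filterS => r; rewrite -XE.
move: t0; rewrite le_eqVlt => /predU1P[<-|t0].
  apply: nearW => r.
  rewrite (_ : weighted_process f xi alpha r 0 = cst 0); last first.
    by apply/funext => w; rewrite /weighted_process eqxx.
  split=> //; rewrite integral0_eq ?lee_fin ?ltW// => w _.
  by rewrite /= expr0n.
pose A := B * ((t j ^+ n) ^+ 2 * (t j `^ N%:R^-1 / t j)).
have A0 : 0 <= A by rewrite mulr_ge0// mulr_ge0 ?sqr_ge0// divr_ge0 ?powR_ge0// ltW.
near=> r.
have r0 : 0 < r by near: r; exact: nbhs_pinfty_gt.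
have rt1 : 1 <= r * t j.
  by rewrite -ler_pdivrMr// div1r; near: r; exact: nbhs_pinfty_ge.
have [mX leX] := moment alpha r (t j) r0 t0 rt1.
split=> //; apply: le_trans leX _; rewrite lee_fin.
by near: r; exact: near_powRN_le.
Unshelve. all: by end_near. Qed.
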